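(* The subgroup $\boldsymbol{\Gamma}=\mathbb H_3(\mathbb Z)$ of $\boldsymbol X=\mathbb H_3(\mathbb R)$ consisting of the matrices with integer coefficients is a lattice of $\boldsymbol X$, and it is adapted for automorphisms of the free group $\mathbb F_2$.
   Context: $\boldsymbol X=\mathbb H_3(\mathbb R)$ is the Heisenberg group of real upper triangular $3\times 3$ matrices with $1$'s on the diagonal. The matrix $\begin{pmatrix}1&x&z\\0&1&y\\0&0&1\end{pmatrix}$ is written $[x,y,z]$, so the group law is $[x,y,z]\bullet[x',y',z']=[x+x',\,y+y',\,z+z'+xy']$. The group $\boldsymbol\Gamma$ is generated by $\boldsymbol n_a=[1,0,0]$ and $\boldsymbol n_b=[0,1,0]$. Let $\mathbb F_2$ be the free group on $\{a,b\}$ and let $\pi:\mathbb F_2\to\boldsymbol\Gamma$ be the surjective homomorphism with $\pi(a)=\boldsymbol n_a$, $\pi(b)=\boldsymbol n_b$. Definition. A topological group $G$ with $m$ generators, with associated surjective homomorphism $\pi:\mathbb F_m\to G$, is called adapted for automorphisms of the free group $\mathbb F_m$ (endowed with its natural topology) if $\pi$ is continuous and there is a continuous surjective homomorphism $\mathfrak S:\mathrm{Aut}(\mathbb F_m)\to \mathrm{Aut}(G)$, $\sigma\mapsto\mathfrak S_\sigma$, such that $\pi\circ\sigma=\mathfrak S_\sigma\circ\pi$ for every $\sigma\in\mathrm{Aut}(\mathbb F_m)$. Here $\mathbb F_2$, $\boldsymbol\Gamma$ and their automorphism groups carry the discrete topology. *)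

(* Defs.v *)
From HB Require Import structures.
From mathcomp Require Import all_boot all_order all_algebra.
From mathcomp Require Import all_classical all_reals all_analysis.
From mathcomp Require Import ring.

Set Implicit Arguments.
Unset Strict Implicit.
Unset Printing Implicit Defensive.

Import Order.TTheory GRing.Theory Num.Theory.
Import numFieldNormedType.Exports.

Local Open Scope classical_set_scope.
Local Open Scope quotient_scope.
Local Open Scope group_scope.

HB.mixin Record isTopologicalGroup G & Topological G & Group G := {
  mulg_continuous : continuous (fun x : G * G => x.1 * x.2) ;
  invg_continuous : continuous (fun x : G => x^-1)
}.

#[short(type="topologicalGroupType")]
HB.structure Definition TopologicalGroup :=
  {G of Topological G & Group G & isTopologicalGroup G}.

Section Subgroup.
Variables (G : topologicalGroupType) (S : groupClosed G).

Record subgroup : Type := Subgroup {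
  subgroup_val : G ;
  subgroup_valP : subgroup_val \in S
}.

HB.instance Definition _ := [isSub for subgroup_val].
HB.instance Definition _ := [Choice of subgroup by <:].

Fact subgroup_closed : group_closed [pred x : G | x \in S].
Proof.
split; first by rewrite inE; exact: gpred1.
by move=> x y; rewrite !inE; exact: gpredF.
Qed.

HB.instance Definition _ :=
  SubChoice_isSubGroup.Build G [pred x : G | x \in S] subgroup subgroup_closed.
HB.instance Definition _ :=
  Topological.copy subgroup (initial_topology subgroup_val).

Lemma subgroup_val_continuous : continuous subgroup_val.
Proof. exact: initial_continuous. Qed.

Fact subgroup_mul_continuous :
  continuous (fun x : subgroup * subgroup => x.1 * x.2).
Proof.
apply: (@continuous_comp_initial _ _ _ subgroup_val) => x.
have -> : subgroup_val \o (fun x : subgroup * subgroup => x.1 * x.2) =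
    (fun x : G * G => x.1 * x.2) \o
    (fun x => (subgroup_val x.1, subgroup_val x.2)).
  by [].
apply: continuous_comp; last exact: mulg_continuous.
apply: cvg_pair => /=; apply: continuous_comp;
  by [exact: cvg_fst|exact: cvg_snd|exact: subgroup_val_continuous].
Qed.

Fact subgroup_inv_continuous : continuous (fun x : subgroup => x^-1).
Proof.
apply: (@continuous_comp_initial _ _ _ subgroup_val) => x.
have -> : subgroup_val \o (fun x : subgroup => x^-1) =
    (fun x : G => x^-1) \o subgroup_val.
  by [].
apply: continuous_comp; last exact: invg_continuous.
exact: subgroup_val_continuous.
Qed.

HB.instance Definition _ := isTopologicalGroup.Build subgroup
  subgroup_mul_continuous subgroup_inv_continuous.

End Subgroup.

Section Lattice.
Variables (G : topologicalGroupType) (S : groupClosed G).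

Definition lcoset_rel : rel G := [rel x y : G | x^-1 * y \in S].

Fact lcoset_rel_equiv : equiv_class_of lcoset_rel.
Proof.
rewrite /lcoset_rel; split => [x|x y|y x z] /=; first by rewrite mulVg gpred1.
  by rewrite -gpredV invgM invgK.
by move=> xy yz; have := gpredM _ _ xy yz; rewrite mulgA mulgK.
Qed.

Canonical lcoset_equiv := EquivRelPack lcoset_rel_equiv.

Definition lcosets : Type := quotient_topology {eq_quot lcoset_equiv}.

HB.instance Definition _ := Topological.on lcosets.
HB.instance Definition _ := Quotient.on lcosets.
HB.instance Definition _ := isPointed.Build lcosets (\pi_lcosets 1).

Definition lcosets_act (g : G) (q : lcosets) : lcosets := \pi_lcosets (g * repr q).

Definition borel_lcosets : Type := g_sigma_algebraType (@open lcosets).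
HB.instance Definition _ := Measurable.on borel_lcosets.

(* The subspace topology on [S] is discrete, and [G / S] carries a nonzero
   finite [G]-invariant Borel measure. When [G] is locally compact and second
   countable, as the Heisenberg group is, a finite Borel measure on [G / S]
   is automatically a Radon measure. *)
Definition is_lattice (R : realType) : Prop :=
  (forall A : set (subgroup S), open A) /\
  exists mu : {measure set borel_lcosets -> \bar R}%R,
    (0 < mu setT < +oo)%E /\
    forall (g : G) (B : set borel_lcosets), measurable B ->
      mu (lcosets_act g @` B) = mu B.

End Lattice.

Section Heisenberg.
Variable R : realType.
Implicit Types x y z : R.

(* [is_trig_mx] is lower triangularity, whence the transpose *)
Definition unitriangular : {pred 'M[R]_3} :=
  [pred A | is_trig_mx A^T && [forall i, A i i == 1%R]].

Record heisenberg : Type := Heisenberg {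
  heis_mx : 'M[R]_3 ;
  heis_mxP : heis_mx \in unitriangular
}.

HB.instance Definition _ := [isSub for heis_mx].
HB.instance Definition _ := [Choice of heisenberg by <:].

Definition heis_coord_mx x y z : 'M[R]_3 :=
  (\matrix_(i, j) (nth [::] [:: [:: 1; x; z]; [:: 0; 1; y]; [:: 0; 0; 1]] i)`_j)%R.

Fact heis_coord_mxP x y z : heis_coord_mx x y z \in unitriangular.
Proof.
rewrite inE; apply/andP; split.
  by apply/is_trig_mxP => -[[|[|[|i]]] // ?] [[|[|[|j]]] // ?]; rewrite !mxE.
by apply/forallP => -[[|[|[|i]]] // ?]; rewrite !mxE.
Qed.

(* the matrix written [x, y, z] *)
Definition heis x y z : heisenberg := Heisenberg (heis_coord_mxP x y z).

Lemma heis_mx_coord (A : heisenberg) :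
  heis_mx A =
    heis_coord_mx (heis_mx A 0 1)%R (heis_mx A 1 ord_max)%R (heis_mx A 0 ord_max)%R.
Proof.
case: A => A /=; rewrite inE => /andP[/is_trig_mxP trA /forallP A1].
have trA0 (i j : 'I_3) : (j < i)%N -> A i j = 0%R.
  by move=> ji; have := trA j i ji; rewrite mxE.
have A11 (i j : 'I_3) : i = j :> nat -> A i j = 1%R.
  by move=> /val_inj <-; exact/eqP.
apply/matrixP => i j; rewrite mxE.
case: i j => [[|[|[|i]]] // i3] [[|[|[|j]]] // j3] /=;
  by [rewrite trA0|rewrite A11|congr (A _ _); apply: val_inj].
Qed.

Lemma heisE (A : heisenberg) :
  A = heis (heis_mx A 0 1)%R (heis_mx A 1 ord_max)%R (heis_mx A 0 ord_max)%R.
Proof. by apply: val_inj; exact: heis_mx_coord. Qed.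

Lemma heis_coord_mxM x y z x' y' z' :
  (heis_coord_mx x y z *m heis_coord_mx x' y' z' =
   heis_coord_mx (x + x') (y + y') (z + z' + x * y'))%R.
Proof.
apply/matrixP => -[[|[|[|i]]] // i3] [[|[|[|j]]] // j3];
  rewrite !mxE !big_ord_recl big_ord0 !mxE /=; ring.
Qed.

Lemma heis_coord_mx0 : (heis_coord_mx 0 0 0 = 1%:M)%R.
Proof.
by apply/matrixP => -[[|[|[|i]]] // i3] [[|[|[|j]]] // j3]; rewrite !mxE.
Qed.

Fact heis_mul_subproof (A B : heisenberg) :
  (heis_mx A *m heis_mx B)%R \in unitriangular.
Proof. by rewrite (heis_mx_coord A) (heis_mx_coord B) heis_coord_mxM heis_coord_mxP. Qed.

Fact heis_one_subproof : 1%:M%R \in unitriangular.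
Proof. by rewrite -heis_coord_mx0 heis_coord_mxP. Qed.

Lemma heis_coord_mxVM x y z :
  (heis_coord_mx (- x) (- y) (x * y - z) *m heis_coord_mx x y z = 1%:M)%R.
Proof. rewrite heis_coord_mxM -heis_coord_mx0; congr heis_coord_mx; ring. Qed.

Fact heis_unit (A : heisenberg) : heis_mx A \in unitmx.
Proof.
rewrite heis_mx_coord.
by have /mulmx1_unit[] := heis_coord_mxVM
  (heis_mx A 0%R 1%R) (heis_mx A 1%R ord_max) (heis_mx A 0%R ord_max).
Qed.

Lemma heis_coord_mxV x y z :
  invmx (heis_coord_mx x y z) = heis_coord_mx (- x)%R (- y)%R (x * y - z)%R.
Proof.
by rewrite -[LHS]mul1mx -(heis_coord_mxVM x y z) mulmxK ?(heis_unit (heis x y z)).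
Qed.

Fact heis_inv_subproof (A : heisenberg) : invmx (heis_mx A) \in unitriangular.
Proof. by rewrite (heis_mx_coord A) heis_coord_mxV heis_coord_mxP. Qed.

Definition heis_mul (A B : heisenberg) := Heisenberg (heis_mul_subproof A B).
Definition heis_one := Heisenberg heis_one_subproof.
Definition heis_inv (A : heisenberg) := Heisenberg (heis_inv_subproof A).

Lemma heis_mulE x y z x' y' z' :
  heis_mul (heis x y z) (heis x' y' z') =
  heis (x + x')%R (y + y')%R (z + z' + x * y')%R.
Proof. by apply: val_inj; exact: heis_coord_mxM. Qed.

Fact heis_mulA : associative heis_mul.
Proof. by move=> A B C; apply: val_inj; exact: mulmxA. Qed.

Fact heis_mul1g : left_id heis_one heis_mul.
Proof. by move=> A; apply: val_inj; exact: mul1mx. Qed.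

Fact heis_mulg1 : right_id heis_one heis_mul.
Proof. by move=> A; apply: val_inj; exact: mulmx1. Qed.

Fact heis_mulVg : left_inverse heis_one heis_inv heis_mul.
Proof. by move=> A; apply: val_inj; exact: mulVmx (heis_unit A). Qed.

Fact heis_mulgV : right_inverse heis_one heis_inv heis_mul.
Proof. by move=> A; apply: val_inj; exact: mulmxV (heis_unit A). Qed.

HB.instance Definition _ := isGroup.Build heisenberg
  heis_mulA heis_mul1g heis_mulg1 heis_mulVg heis_mulgV.

HB.instance Definition _ :=
  Topological.copy heisenberg (initial_topology heis_mx).

Lemma heis_mx_continuous : continuous heis_mx.
Proof. exact: initial_continuous. Qed.

Lemma heis_coord_continuous (i j : 'I_3) :
  continuous (fun A : heisenberg => heis_mx A i j).
Proof.
move=> A; apply: (@continuous_comp _ _ _ heis_mx (fun M => M i j)).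
  exact: heis_mx_continuous.
exact: coord_continuous.
Qed.

Lemma heis_coord_mx_continuous (T : topologicalType) (f g h : T -> R) :
  continuous f -> continuous g -> continuous h ->
  continuous (fun t => heis_coord_mx (f t) (g t) (h t)).
Proof.
move=> fc gc hc t B [P /= PB sPB]; apply: filterS sPB _; apply: filter_forall => i; apply: filter_forall => j.
suff : continuous (fun u => heis_coord_mx (f u) (g u) (h u) i j).
  by move=> /(_ t); apply; exact: PB.
have -> : (fun u => heis_coord_mx (f u) (g u) (h u) i j) =
  (fun u => (nth [::] [:: [:: 1; f u; h u]; [:: 0; 1; g u]; [:: 0; 0; 1]] i)`_j)%R.
  by apply/funext => u; rewrite mxE.
by case: i j => [[|[|[|i]]] // i3] [[|[|[|j]]] // j3] /=;
  first [exact: fc|exact: gc|exact: hc|exact: cst_continuous].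
Qed.

Fact heis_mul_continuous :
  continuous (fun x : heisenberg * heisenberg => x.1 * x.2).
Proof.
apply: (@continuous_comp_initial _ _ _ heis_mx).
pose c i j (A : heisenberg) : R := heis_mx A i j.
have c1 i j : continuous (fun x : heisenberg * heisenberg => c i j x.1).
  by move=> x; apply: continuous_comp; [exact: cvg_fst|exact: heis_coord_continuous].
have c2 i j : continuous (fun x : heisenberg * heisenberg => c i j x.2).
  by move=> x; apply: continuous_comp; [exact: cvg_snd|exact: heis_coord_continuous].
pose o := (ord_max : 'I_3).
have -> : heis_mx \o (fun x : heisenberg * heisenberg => x.1 * x.2) = (fun p =>
    heis_coord_mx (c 0 1 p.1 + c 0 1 p.2) (c 1 o p.1 + c 1 o p.2)
      (c 0 o p.1 + c 0 o p.2 + c 0 1 p.1 * c 1 o p.2))%R.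
  apply/funext => -[A B] /=; rewrite -heis_coord_mxM.
  by rewrite /c -!heis_mx_coord.
by apply: heis_coord_mx_continuous => x; do ?[apply: cvgD|apply: cvgM];
  by [exact: c1|exact: c2].
Qed.

Fact heis_inv_continuous : continuous (fun x : heisenberg => x^-1).
Proof.
apply: (@continuous_comp_initial _ _ _ heis_mx).
pose c i j (A : heisenberg) : R := heis_mx A i j.
pose o := (ord_max : 'I_3).
have -> : heis_mx \o (fun x : heisenberg => x^-1) = (fun p =>
    heis_coord_mx (- c 0 1 p) (- c 1 o p) (c 0 1 p * c 1 o p - c 0 o p))%R.
  by apply/funext => A /=; rewrite -heis_coord_mxV /c -heis_mx_coord.
have cc i j : continuous (c i j) by exact: heis_coord_continuous.
apply: heis_coord_mx_continuous => x; [exact: cvgN (cc _ _ x)|exact: cvgN (cc _ _ x)|].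
exact: cvgB (cvgM (cc _ _ x) (cc _ _ x)) (cc _ _ x).
Qed.

HB.instance Definition _ := isTopologicalGroup.Build heisenberg
  heis_mul_continuous heis_inv_continuous.

Definition heisZ : {pred heisenberg} :=
  [pred A | [forall i, [forall j, heis_mx A i j \is a Num.int]]].

Lemma heisZP (A : heisenberg) :
  reflect (forall i j, heis_mx A i j \is a Num.int) (A \in heisZ).
Proof.
rewrite inE; apply: (iffP forallP) => AZ i; last exact/forallP.
by move=> j; have /forallP := AZ i.
Qed.

Lemma heis_heisZ x y z : heis x y z \in heisZ =
  [&& x \is a Num.int, y \is a Num.int & z \is a Num.int].
Proof.
apply/heisZP/and3P => [H|[xZ yZ zZ] i j].
  have := (H 0 1, H 1 ord_max, H 0 ord_max)%R.
  by rewrite !mxE /= => -[[? ?] ?].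
by rewrite mxE; case: i j => [[|[|[|i]]] // i3] [[|[|[|j]]] // j3] /=.
Qed.

Fact heisZ_mul : mulg_closed heisZ.
Proof.
move=> A B; rewrite (heisE A) (heisE B) [_ * _]heis_mulE !heis_heisZ.
move=> /and3P[? ? ?] /and3P[? ? ?].
by apply/and3P; split; do ?[apply: rpredD|apply: rpredM].
Qed.

Fact heisZ_one : 1 \in heisZ.
Proof. by apply/heisZP => i j; rewrite mxE; case: eqP. Qed.

Fact heisZ_inv : invg_closed heisZ.
Proof.
move=> A; rewrite (heisE A) => AZ.
have -> : (heis (heis_mx A 0 1) (heis_mx A 1 ord_max) (heis_mx A 0 ord_max))%R^-1 =
    heis (- heis_mx A 0 1)%R (- heis_mx A 1 ord_max)%R
      (heis_mx A 0 1 * heis_mx A 1 ord_max - heis_mx A 0 ord_max)%R.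
  by apply: val_inj; exact: heis_coord_mxV.
move: AZ; rewrite !heis_heisZ => /and3P[? ? ?].
by apply/and3P; split; do ?[apply: rpredB|apply: rpredM|rewrite rpredN].
Qed.

HB.instance Definition _ := isMulClosed.Build heisenberg heisZ heisZ_mul.
HB.instance Definition _ := isMul1Closed.Build heisenberg heisZ heisZ_one.
HB.instance Definition _ := isInvClosed.Build heisenberg heisZ heisZ_inv.

End Heisenberg.

Arguments heisZ : clear implicits.

Section FreeGroup.
Variable m : nat.

(* The free group consists of the reduced words, with product the reduction
   of the concatenation; [(i, false)] is the generator [i], [(i, true)]
   is its inverse. *)
Definition letter : Type := ('I_m * bool)%type.
HB.instance Definition _ := Choice.on letter.
Implicit Types (x y : letter) (s t u : seq letter).

Definition letter_inv x : letter := (x.1, ~~ x.2).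

Definition reduced : pred (seq letter) := sorted [rel x y | y != letter_inv x].

Record free_group : Type := FreeGroup {
  free_word : seq letter ;
  free_wordP : reduced free_word
}.

HB.instance Definition _ := [isSub for free_word].
HB.instance Definition _ := [Choice of free_group by <:].

Definition reduced_cons x s : seq letter :=
  if s is y :: s' then if y == letter_inv x then s' else x :: s else [:: x].

Definition reduced_cat s t : seq letter := foldr reduced_cons t s.

Lemma letter_invK : involutive letter_inv.
Proof. by case=> i b; rewrite /letter_inv /= negbK. Qed.

Lemma reduced_consP x s : reduced s -> reduced (reduced_cons x s).
Proof.
case: s => [|y s] //= ys; case: eqP => [_|/eqP yx]; first exact: path_sorted ys.
by rewrite /= yx.
Qed.

Lemma reduced_catP s t : reduced t -> reduced (reduced_cat s t).
Proof. by move=> rt; elim: s => //= x s; exact: reduced_consP. Qed.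

Lemma reduced_consE x s : reduced (x :: s) -> reduced_cons x s = x :: s.
Proof. by case: s => [|y s] //= /andP[/negPf ->]. Qed.

Lemma reduced_consK x s : reduced s ->
  reduced_cons (letter_inv x) (reduced_cons x s) = s.
Proof.
case: s => [|y s] /= rs; first by rewrite letter_invK eqxx.
case: eqP => [yx|_]; last by rewrite /= letter_invK eqxx.
by subst y; rewrite reduced_consE.
Qed.

Lemma reduced_cat_cons x s t : reduced t ->
  reduced_cat (reduced_cons x s) t = reduced_cons x (reduced_cat s t).
Proof.
move=> rt; case: s => [|y s] //=; case: eqP => [->|//] /=.
by rewrite -{1}[x]letter_invK reduced_consK //; exact: reduced_catP.
Qed.

Lemma reduced_catA s t u : reduced u ->
  reduced_cat s (reduced_cat t u) = reduced_cat (reduced_cat s t) u.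
Proof. by move=> ru; elim: s => //= x s ->; rewrite reduced_cat_cons. Qed.

Lemma reduced_cats0 s : reduced s -> reduced_cat s [::] = s.
Proof.
elim: s => //= x s IHs xs; rewrite IHs; first exact: reduced_consE.
exact: path_sorted xs.
Qed.

Definition word_inv s : seq letter := rev (map letter_inv s).

Lemma word_inv_reduced s : reduced s -> reduced (word_inv s).
Proof.
rewrite /reduced /word_inv rev_sorted sorted_map; apply: sub_sorted => x y /=.
by rewrite letter_invK eq_sym => /eqP xy; apply/eqP => yx; apply: xy.
Qed.

Lemma word_invK : involutive word_inv.
Proof. by move=> s; rewrite /word_inv map_rev revK (mapK letter_invK). Qed.

Lemma reduced_cat_inv s t : reduced t ->
  reduced_cat (word_inv s) (reduced_cat s t) = t.
Proof.
elim: s t => //= x s IHs t rt; rewrite /word_inv /= rev_cons -cats1.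
rewrite /reduced_cat foldr_cat /= reduced_consK; last exact: reduced_catP.
exact: IHs.
Qed.

Definition free_mul (v w : free_group) : free_group :=
  FreeGroup (reduced_catP (free_word v) (free_wordP w)).
Definition free_one : free_group := @FreeGroup [::] isT.
Definition free_inv (w : free_group) : free_group :=
  FreeGroup (word_inv_reduced (free_wordP w)).

Fact free_mulA : associative free_mul.
Proof.
by move=> u v w; apply: val_inj; apply: reduced_catA; exact: free_wordP.
Qed.

Fact free_mul1g : left_id free_one free_mul.
Proof. by move=> w; exact: val_inj. Qed.

Fact free_mulg1 : right_id free_one free_mul.
Proof. by move=> w; apply: val_inj; apply: reduced_cats0; exact: free_wordP. Qed.

Fact free_mulVg : left_inverse free_one free_inv free_mul.
Proof.
move=> w; apply: val_inj => /=.
by rewrite -{2}[free_word w]reduced_cats0 ?free_wordP// reduced_cat_inv.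
Qed.

Fact free_mulgV : right_inverse free_one free_inv free_mul.
Proof.
move=> w; rewrite -{1}[w](_ : free_inv (free_inv w) = w); first exact: free_mulVg.
by apply: val_inj; exact: word_invK.
Qed.

HB.instance Definition _ := isGroup.Build free_group
  free_mulA free_mul1g free_mulg1 free_mulVg free_mulgV.

HB.instance Definition _ :=
  DiscreteTopology.copy free_group (discrete_topology free_group).

Fact free_mul_continuous :
  continuous (fun x : free_group * free_group => x.1 * x.2).
Proof.
move=> [u v] A /nbhs_singleton Auv; exists ([set u], [set v]).
  by split; exact: discrete_set1.
by move=> [u' v'] /= [-> ->].
Qed.

Fact free_inv_continuous : continuous (fun w : free_group => w^-1).
Proof. by apply/continuousP => A _; exact: discrete_open. Qed.

HB.instance Definition _ := isTopologicalGroup.Build free_group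
  free_mul_continuous free_inv_continuous.

Definition free_gen (i : 'I_m) : free_group := @FreeGroup [:: (i, false)] isT.

End FreeGroup.

Section Automorphism.
Variable G : topologicalGroupType.

Definition is_automorphism (f : G -> G) : Prop :=
  [/\ {morph f : x y / x * y}, continuous f &
    exists g, [/\ cancel f g, cancel g f & continuous g]].

Record automorphism : Type := Automorphism {
  aut_fun :> G -> G ;
  aut_axiom : `[< is_automorphism aut_fun >]
}.

HB.instance Definition _ := [isSub for aut_fun].
HB.instance Definition _ := [Choice of automorphism by <:].

Lemma autP (f : automorphism) : is_automorphism f.
Proof. by case: f => f /= /asboolP. Qed.

Lemma autM (f : automorphism) : {morph f : x y / x * y}.
Proof. by case: (autP f). Qed.

Lemma aut_inv_ex (f : automorphism) :
  exists g, [/\ cancel f g, cancel g f & continuous g].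
Proof. by case: (autP f). Qed.

Definition aut_inv_fun (f : automorphism) : G -> G := projT1 (cid (aut_inv_ex f)).

Lemma aut_funK (f : automorphism) : cancel f (aut_inv_fun f).
Proof. by rewrite /aut_inv_fun; case: cid => g /= []. Qed.

Lemma aut_inv_funK (f : automorphism) : cancel (aut_inv_fun f) f.
Proof. by rewrite /aut_inv_fun; case: cid => g /= []. Qed.

Lemma aut_inv_continuous (f : automorphism) : continuous (aut_inv_fun f).
Proof. by rewrite /aut_inv_fun; case: cid => g /= []. Qed.

Fact aut_mul_subproof (f g : automorphism) : `[< is_automorphism (f \o g) >].
Proof.
have [fM fc [f' [fK f'K f'c]]] := autP f.
have [gM gc [g' [gK g'K g'c]]] := autP g.
apply/asboolP; split; first by move=> x y /=; rewrite gM fM.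
  by move=> x; apply: continuous_comp; [exact: gc|exact: fc].
exists (g' \o f'); split; [exact: can_comp|exact: can_comp|].
by move=> x; apply: continuous_comp; [exact: f'c|exact: g'c].
Qed.

Fact aut_one_subproof : `[< is_automorphism (@id G) >].
Proof.
have idc : continuous (@id G) by move=> x; exact: cvg_id.
by apply/asboolP; split => //; exists id; split.
Qed.

Fact aut_inv_subproof (f : automorphism) :
  `[< is_automorphism (aut_inv_fun f) >].
Proof.
apply/asboolP; split; last first.
- exists f; split; [exact: aut_inv_funK|exact: aut_funK|].
  by case: (autP f).
- exact: aut_inv_continuous.
- move=> x y; apply: (can_inj (aut_funK f)).
  by rewrite autM !aut_inv_funK.
Qed.

Definition aut_mul (f g : automorphism) := Automorphism (aut_mul_subproof f g).
Definition aut_one := Automorphism aut_one_subproof.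
Definition aut_inv (f : automorphism) := Automorphism (aut_inv_subproof f).

Fact aut_mulA : associative aut_mul.
Proof. by move=> f g h; exact: val_inj. Qed.

Fact aut_mul1g : left_id aut_one aut_mul.
Proof. by move=> f; exact: val_inj. Qed.

Fact aut_mulg1 : right_id aut_one aut_mul.
Proof. by move=> f; exact: val_inj. Qed.

Fact aut_mulVg : left_inverse aut_one aut_inv aut_mul.
Proof. by move=> f; apply: val_inj; apply/funext => x; exact: aut_funK. Qed.

Fact aut_mulgV : right_inverse aut_one aut_inv aut_mul.
Proof. by move=> f; apply: val_inj; apply/funext => x; exact: aut_inv_funK. Qed.

HB.instance Definition _ := isGroup.Build automorphism
  aut_mulA aut_mul1g aut_mulg1 aut_mulVg aut_mulgV.

(* The discrete topology is the intended one when [G] is a discrete group,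
   which is the only case needed here. Since [automorphism (free_group m)] is
   then discrete, continuity of a map defined on it does not depend on the
   topology chosen on its codomain. *)
HB.instance Definition _ :=
  DiscreteTopology.copy automorphism (discrete_topology automorphism).

End Automorphism.

Definition adapted (m : nat) (G : topologicalGroupType)
    (pi : {multiplicative free_group m -> G}) : Prop :=
  [/\ continuous pi, range pi = setT &
    exists S : {multiplicative automorphism (free_group m) -> automorphism G},
      [/\ continuous S, range S = setT &
        forall (sigma : automorphism (free_group m)) (w : free_group m),
          pi (sigma w) = S sigma (pi w)]].

(* Main.v *)
Require Import Defs.
From HB Require Import structures.
From mathcomp Require Import all_boot all_order all_algebra.
From mathcomp Require Import all_classical all_reals all_analysis.
From mathcomp Require Import measurable_realfun ring lra zify.

Set Implicit Arguments.
Unset Strict Implicit.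
Unset Printing Implicit Defensive.

Import Order.TTheory GRing.Theory Num.Theory.
Import numFieldNormedType.Exports.

(** Two independent arguments.

    Lattice. Integers are isolated among the reals, so the integer matrices
    are discrete ([heisZ_discrete]). The cosets of [heisZ R] are parametrized
    by the unit cube: [x, y, z] and [x + 1, y, z], [x, y + 1, z + x],
    [x, y, z + 1] lie in the same coset. The invariant measure is the image
    of Lebesgue measure on the cube. A left translation acts on coordinates
    by the shear (x, y, z) |-> (x + a, y + b, z + c + a y), and Fubini reduces
    its invariance to three one-dimensional statements, each saying that the
    integral of a 1-periodic function over a period is unchanged by a
    translation ([integral_uniform_periodic], [cube_prob_shear]): the fibres
    in z are periodic, their measure is then periodic in y because the twist
    z + x is absorbed by translation invariance along the fibre, and the
    integral over y is periodic in x.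

    Automorphisms. The integral Heisenberg group is the free nilpotent group
    of class 2 on [1, 0, 0] and [0, 1, 0]: any two of its elements are the
    images of these generators under an endomorphism ([heis_endo]). Hence for
    each automorphism s of the free group, pi o s factors through pi
    ([hom_factor_heis]), and the factor depends multiplicatively on s
    ([heis_push]). For surjectivity, an automorphism of the Heisenberg group
    is given by a pair of elements whose images in the abelianization Z^2
    have determinant 1 or -1 ([aut_det]). Precomposing lifts with Nielsen
    moves on the free group performs row operations on such a pair, so the
    Euclidean algorithm reduces it to [1, 0, r], [0, 1, u]; this last pair is
    a conjugate of the generators, realized by an inner automorphism
    ([liftable_det]). *)

(** * Translation of periodic functions *)

(** The measurability proof is an argument because unification cannot recover
    it from [pushforward m f] alone. *)
Definition image_measure (d d' : measure_display) (T1 : measurableType d)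
    (T2 : measurableType d') (R : realType)
    (m : {measure set T1 -> \bar R}%R) (f : T1 -> T2)
    (mf : measurable_fun [set: T1]%classic f) :
    {measure set T2 -> \bar R}%R :=
  measure_function_pushforward__canonical__measure_function_Measure m mf.

Section PeriodicIntegral.
Variable R : realType.
Local Open Scope classical_set_scope.
Local Open Scope ring_scope.

Local Notation mu := (@lebesgue_measure R).

Lemma measurable_addr (a : R) :
  measurable_fun setT (fun x : measurableTypeR R => x + a : measurableTypeR R).
Proof. exact: measurable_funD. Qed.

(** A measure that agrees with Lebesgue measure on half-open intervals is
    equal to it, and translation preserves lengths. *)
Lemma lebesgue_measure_shift (a : R) (A : set (measurableTypeR R)) :
  measurable A -> mu ((fun x => x + a) @^-1` A) = mu A.
Proof.
move=> mA; pose nu := image_measure mu (measurable_addr a).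
symmetry; apply: (lebesgue_measure_unique (mu := nu)) => // X.
move=> /ocitvP[->|[[b c] /= bc ->]]; first by rewrite !measure0.
rewrite -[RHS]/(mu ((fun x => x + a) @^-1` `]b, c])).
have -> : (fun x => x + a) @^-1` `]b, c] = [set` `]b - a, c - a]].
  by apply/seteqP; split=> x /=; rewrite !in_itv /= ltrBlDr lerBrDr.
rewrite !lebesgue_measure_itv /= !lte_fin ltrD2r; case: ifP => // _.
by rewrite -!EFinB; congr (_%:E); ring.
Qed.

Lemma integral_shift (a c d : R) (h : R -> \bar R) :
  measurable_fun setT h -> (forall x, 0 <= h x)%E ->
  (\int[mu]_(x in `[c, d[) h (x + a)%R =
   \int[mu]_(x in `[(c + a)%R, (d + a)%R[) h x)%E.
Proof.
move=> mh h0.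
have -> : `[c, d[%classic =
    (fun x => x + a) @^-1` `[c + a, d + a[%classic :> set R.
  by apply/seteqP; split=> x /=; rewrite !in_itv /= lerD2r ltrD2r.
rewrite -(ge0_integral_pushforward (measurable_addr a) mu (f := h)) //.
  pose nu := image_measure mu (measurable_addr a).
  apply: (@eq_measure_integral _ _ _ _ mu nu) => A mA _.
  exact: lebesgue_measure_shift.
exact: measurable_funTS.
Qed.

Local Notation U := (uniform_prob (@ltr01 R)).

Lemma integral_uniform01 (h : R -> \bar R) :
  measurable_fun setT h -> (forall x, 0 <= h x)%E ->
  (\int[U]_x h x = \int[mu]_(x in `[0%R, 1%R[) h x)%E.
Proof.
move=> mh h0; rewrite integral_uniform // subr0 invr1 mul1e.
by rewrite -integral_itv_bndo_bndc //; exact: measurable_funTS.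
Qed.

Section Periodic.
Variable h : R -> \bar R.
Hypotheses (mh : measurable_fun setT h) (h0 : forall x, (0 <= h x)%E).
Hypothesis h1 : forall x, h (x + 1) = h x.

Lemma periodic_int x (n : int) : h (x + n%:~R) = h x.
Proof.
have hn (m : nat) y : h (y + m%:R) = h y.
  by elim: m y => [|m IHm] y; rewrite ?addr0 // -natr1 addrA h1 IHm.
case: n => n; first exact: hn.
by rewrite -[in RHS](subrK n.+1%:R x) hn NegzE rmorphN.
Qed.

Lemma integral_setU_co (a b c : R) : a <= b -> b <= c ->
  (\int[mu]_(x in `[a, c[) h x =
   \int[mu]_(x in `[a, b[) h x + \int[mu]_(x in `[b, c[) h x)%E.
Proof.
move=> ab bc; rewrite -ge0_integral_setU //=; last 2 first.
- exact: measurable_funTS.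
- apply/disj_setPLR => x /=; rewrite !in_itv /= => /andP[_ xb] /andP[]; lra.
by congr (integral _ _ _); rewrite -itv_bndbnd_setU.
Qed.

(** By periodicity the translation may be taken to be by some t with
    0 <= t < 1; the part of the translated unit interval that lies between 1
    and 1 + t is then brought back between 0 and t by periodicity again. *)
Lemma integral_uniform_periodic (a : R) :
  (\int[U]_x h (x + a)%R = \int[U]_x h x)%E.
Proof.
pose n := Num.floor a; pose t := a - n%:~R.
have /andP[t0 t1] : 0 <= t < 1.
  by rewrite subr_ge0 ge_floor /= ltrBlDl -intrD1 floorD1_gt.
have -> : (fun x => h (x + a)) = (fun x => h (x + t)).
  by apply/funext => x; rewrite -(periodic_int (x + t) n) /t; congr h; ring.
rewrite !integral_uniform01 //; last first.
  by apply: (measurableT_comp mh); exact: measurable_addr.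
rewrite integral_shift // add0r.
rewrite (@integral_setU_co t 1) ?lerDl //; last exact: ltW.
rewrite (@integral_setU_co 0 t 1) //; last exact: ltW.
rewrite addeC; congr (_ + _)%E.
(* what remains is [1, 1 + t[ against its translate [0, t[ *)
rewrite -[in LHS](add0r 1) (addrC (0 + 1) t) add0r -{1}[1](add0r 1).
rewrite -integral_shift //.
by apply: eq_integral => x _; rewrite h1.
Qed.

End Periodic.

Lemma uniform_periodic (A : set R) (a : R) :
  measurable A -> (forall x, A (x + 1) <-> A x) ->
  U [set x | A (x + a)] = U A.
Proof.
move=> mA A1.
have mAa : measurable [set x | A (x + a)].
  by rewrite -[X in measurable X]setTI; exact: (measurable_addr a).
have UE B : measurable B -> U B = (\int[U]_x (\1_B x)%:E)%E.
  by move=> mB; rewrite integral_indic // setIT.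
rewrite !UE // -(@integral_uniform_periodic (fun x => (\1_A x)%:E) _ _ _ a).
- apply: eq_integral => x _; rewrite !indicE.
  have -> // : (x \in [set x | A (x + a)]) = (x + a \in A).
  by apply/idP/idP; rewrite !inE.
- exact/measurable_EFinP/measurable_indic.
- by move=> x; rewrite lee_fin.
- move=> x; rewrite !indicE.
  have -> // : (x + 1 \in A) = (x \in A).
  by apply/idP/idP; rewrite !inE => /A1.
Qed.

Notation RM := (measurableTypeR R).

Definition cube_prob : probability (RM * (RM * RM))%type R :=
  (U \x (U \x U))%E.

End PeriodicIntegral.

(** * The lattice *)

Section OpenMeasurable.
Variable R : realType.
Local Open Scope classical_set_scope.
Local Open Scope ring_scope.

Notation RM := (measurableTypeR R).

(** The product sigma-algebra contains the open boxes, and an open set is the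
    union of the countably many boxes with rational centre and radius that it
    contains. *)
Lemma open_measurable3 (O : set (R * (R * R))) :
  open O -> @measurable _ (RM * (RM * RM))%type O.
Proof.
move=> oO.
pose box (i : rat * (rat * rat) * rat) : set (R * (R * R)) :=
  ball (ratr i.1.1 : R, (ratr i.1.2.1 : R, ratr i.1.2.2 : R)) (ratr i.2 : R).
have mbox i : @measurable _ (RM * (RM * RM))%type (box i).
  have -> : box i = ball (ratr i.1.1 : R) (ratr i.2) `*`
      (ball (ratr i.1.2.1 : R) (ratr i.2) `*`
       ball (ratr i.1.2.2 : R) (ratr i.2)) by [].
  apply: measurableX; [|apply: measurableX]; exact: measurable_ball.
have -> : O = \bigcup_(i in [set i | box i `<=` O]) box i.
  apply/seteqP; split; last by move=> p [i iO]; exact: iO.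
  move=> p Op; have /nbhs_ballP[e /= e0 eO] : nbhs p O by exact: open_nbhs_nbhs.
  have [d] : exists d : rat, (ratr d : R) \in `]0, e / 2[.
    by apply: rat_in_itvoo; rewrite divr_gt0.
  rewrite in_itv /= => /andP[d0 de].
  have near (x : R) : exists q : rat, ball (ratr q : R) (ratr d) x.
    have [q] : exists q : rat, (ratr q : R) \in `]x - ratr d, x + ratr d[.
      by apply: rat_in_itvoo; lra.
    rewrite in_itv /= => /andP[q1 q2]; exists q.
    by rewrite /ball /= ltr_norml; apply/andP; split; lra.
  have [q1 pq1] := near p.1; have [q2 pq2] := near p.2.1.
  have [q3 pq3] := near p.2.2.
  have pbox : box ((q1, (q2, q3)), d) p by [].
  exists ((q1, (q2, q3)), d) => //= r rbox; apply: eO.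
  apply: (@le_ball _ _ _ (ratr d + ratr d)); first lra.
  by apply: ball_triangle rbox; apply: ball_sym.
rewrite bigcup_mkcond; apply: countable_bigcupT_measurable => [|i].
  exact: countableP.
by case: ifP.
Qed.

End OpenMeasurable.

Section HeisenbergLattice.
Variable R : realType.
Local Open Scope classical_set_scope.
Local Open Scope quotient_scope.
Local Open Scope ring_scope.

Notation X := (heisenberg R).
Notation Y := (lcosets (heisZ R)).
Notation RM := (measurableTypeR R).

(** Integer matrices closer than 1 to each other, entry by entry, are equal. *)
Lemma heisZ_discrete (A : set (subgroup (heisZ R))) : open A.
Proof.
rewrite openE => g Ag; rewrite /interior.
pose c i j (h : subgroup (heisZ R)) : R := heis_mx (subgroup_val h) i j.
have cc i j : continuous (c i j).
  move=> h; apply: (@continuous_comp _ _ _ (@subgroup_val _ (heisZ R))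
    (fun B : X => heis_mx B i j)).
    exact: subgroup_val_continuous.
  exact: heis_coord_continuous.
have cg i j : \forall h \near g, c i j h = c i j g.
  have : \forall h \near g, ball (c i j g) 1 (c i j h).
    by apply: cc; exact: nbhsx_ballx.
  apply: filterS => h; rewrite /ball /= => hg.
  have /heisZP/(_ i j)/intrP[m mE] := subgroup_valP g.
  have /heisZP/(_ i j)/intrP[n nE] := subgroup_valP h.
  move: hg; rewrite /c mE nE -intrB -intr_norm -[1]/(1%:~R) ltr_int => hg.
  by congr (_%:~R); lia.
have : \forall h \near g, forall i, forall j, c i j h = c i j g.
  have near_fin (f : 'I_3 -> set (subgroup (heisZ R))) :
      (forall i, \forall h \near g, f i h) ->
      \forall h \near g, forall i, f i h.
    exact: (@filter_forall _ _ f (nbhs g) _).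
  apply: (near_fin (fun i h => forall j, c i j h = c i j g)) => i.
  exact: near_fin.
apply: filterS => h hg; suff -> : h = g by [].
by apply/val_inj/val_inj/matrixP => i j; exact: hg.
Qed.

Lemma heis_mulgE (x y z x' y' z' : R) :
  (heis x y z * heis x' y' z')%g = heis (x + x') (y + y') (z + z' + x * y').
Proof. exact: heis_mulE. Qed.

Definition heis_coset (p : RM * (RM * RM)) : borel_lcosets (heisZ R) :=
  \pi_Y (heis p.1 p.2.1 p.2.2).

Lemma pi_mulr (g h : X) : h \in heisZ R -> \pi_Y (g * h)%g = \pi_Y g.
Proof.
move=> hZ; apply/esym/eqmodP; rewrite /= /equiv /= /lcoset_rel /=.
by rewrite mulKg.
Qed.

Lemma heis_coset_addx x y z :
  heis_coset (x + 1, (y, z)) = heis_coset (x, (y, z)).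
Proof.
rewrite /heis_coset /= -(@pi_mulr (heis x y z) (heis 1 0 0)); last first.
  by rewrite heis_heisZ rpred1 rpred0.
by rewrite heis_mulgE; congr (\pi_Y (heis _ _ _)); ring.
Qed.

Lemma heis_coset_addy x y z :
  heis_coset (x, (y + 1, z + x)) = heis_coset (x, (y, z)).
Proof.
rewrite /heis_coset /= -(@pi_mulr (heis x y z) (heis 0 1 0)); last first.
  by rewrite heis_heisZ rpred1 rpred0.
by rewrite heis_mulgE; congr (\pi_Y (heis _ _ _)); ring.
Qed.

Lemma heis_coset_addz x y z :
  heis_coset (x, (y, z + 1)) = heis_coset (x, (y, z)).
Proof.
rewrite /heis_coset /= -(@pi_mulr (heis x y z) (heis 0 0 1)); last first.
  by rewrite heis_heisZ rpred1 rpred0.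
by rewrite heis_mulgE; congr (\pi_Y (heis _ _ _)); ring.
Qed.

Lemma heis_continuous :
  continuous (fun p : R * (R * R) => heis p.1 p.2.1 p.2.2 : X).
Proof.
apply: (@continuous_comp_initial _ _ _ (@heis_mx R)).
apply: heis_coord_mx_continuous => p.
- exact: cvg_fst.
- by apply: continuous_comp; [exact: cvg_snd|exact: cvg_fst].
- by apply: continuous_comp; [exact: cvg_snd|exact: cvg_snd].
Qed.

Lemma measurable_heis_coset : measurable_fun setT heis_coset.
Proof.
move=> mT.
apply: (@measurability _ _ _ _ setT heis_coset (@open Y)) => // _ [V oV <-].
rewrite setTI; apply: open_measurable3.
(* [oV] is by definition openness of the preimage of V in the group *)
by have /continuousP/(_ _ oV) := heis_continuous.
Qed.

(** The sets E below are abstract preimages of sets of cosets: the three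
    periodicities are those of [heis_coset]. *)
Section Invariance.
Variable E : set (RM * (RM * RM)).
Hypothesis mE : measurable E.
Hypothesis Ex : forall x y z, E (x + 1, (y, z)) <-> E (x, (y, z)).
Hypothesis Ey : forall x y z, E (x, (y + 1, z + x)) <-> E (x, (y, z)).
Hypothesis Ez : forall x y z, E (x, (y, z + 1)) <-> E (x, (y, z)).

Local Notation U := (uniform_prob (@ltr01 R)).

Let F x y := U (xsection (xsection E x) y).

Lemma fibre_shift x y a : U [set z | E (x, (y, z + a))] = F x y.
Proof.
rewrite /F !xsectionE.
have mA : measurable [set z | E (x, (y, z))].
  rewrite (_ : [set z | _] = xsection (xsection E x) y).
    by do 2!(apply: measurable_xsection).
  by rewrite !xsectionE.
by apply: (uniform_periodic a mA) => z; exact: Ez.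
Qed.

(** Fubini: the shear translates the fibre over (x, y), then y, then x, and
    each translation leaves the corresponding integral unchanged. *)
Lemma cube_prob_shear (a b c : R) :
  cube_prob R [set p | E (p.1 + a, (p.2.1 + b, p.2.2 + (c + a * p.2.1)))] =
  cube_prob R E.
Proof.
have F0 x y : (0 <= F x y)%E by [].
have mF x : measurable_fun setT (F x).
  exact/measurable_fun_xsection/measurable_xsection.
have Fx x y : F (x + 1) y = F x y.
  by rewrite /F !xsectionE; congr (U _); apply/seteqP; split=> z /= /Ex.
have Fy x y : F x (y + 1) = F x y.
  (* going round in y translates the fibre by x *)
  rewrite -(fibre_shift x y (- x)) /F !xsectionE.
  congr (U _); apply/seteqP; split=> z /=;
    by have := Ey x y (z - x); rewrite subrK => -[].
transitivity (\int[U]_x \int[U]_y F (x + a)%R (y + b)%R)%E.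
  apply: eq_integral => x _; apply: eq_integral => y _.
  rewrite -(fibre_shift (x + a) (y + b) (c + a * y)).
  by rewrite /= !xsectionE.
transitivity (\int[U]_x \int[U]_y F (x + a)%R y)%E.
  apply: (@eq_integral _ RM) => x _.
  by apply: integral_uniform_periodic => //; exact: mF.
transitivity (\int[U]_x \int[U]_y F x y)%E; last by [].
pose H (x : R) := (\int[U]_y F x y)%E.
apply: (@integral_uniform_periodic _ H).
- pose UU : probability (RM * RM)%type R := (U \x U)%E.
  exact: (measurable_fun_xsection UU mE).
- by move=> x; apply: integral_ge0.
- by move=> x; apply: eq_integral => y _.
Qed.

End Invariance.

Definition heis_measure : {measure set (borel_lcosets (heisZ R)) -> \bar R} :=
  image_measure (cube_prob R) measurable_heis_coset.

(** [lcosets_act] is defined through representatives; its value does not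
    depend on the one chosen. *)
Lemma lcosets_act_pi (g h : X) : lcosets_act g (\pi_Y h) = \pi_Y (g * h)%g.
Proof.
rewrite /lcosets_act.
have repr_h : ((repr (\pi_Y h))^-1 * h)%g \in heisZ R.
  by have /eqmodP := reprK (\pi_Y h).
by rewrite -(pi_mulr _ repr_h) mulgA mulgK.
Qed.

Lemma heis_measure_invariant (g : X) (B : set (borel_lcosets (heisZ R))) :
  measurable B -> heis_measure (lcosets_act g @` B) = heis_measure B.
Proof.
move=> mB; have [a [b [c gE]]] : exists a b c, (g^-1)%g = heis a b c.
  by do 3!eexists; exact: heisE.
have mE : measurable (heis_coset @^-1` B).
  by rewrite -[X in measurable X]setTI; exact: measurable_heis_coset.
rewrite -[RHS]/(cube_prob R (heis_coset @^-1` B)).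
(* in coordinates, left multiplication by g^-1 is the shear *)
rewrite -(cube_prob_shear mE _ _ _ a b c).
- rewrite -[LHS]/(cube_prob R (heis_coset @^-1` (lcosets_act g @` B))).
  congr (cube_prob R _).
  have actV (p : RM * (RM * RM)) :
      heis_coset (p.1 + a, (p.2.1 + b, p.2.2 + (c + a * p.2.1)))
      = lcosets_act g^-1%g (heis_coset p).
    rewrite /heis_coset /= lcosets_act_pi gE heis_mulgE.
    by congr (\pi_Y (heis _ _ _)); ring.
  have actK (k : X) : cancel (@lcosets_act _ (heisZ R) k) (lcosets_act k^-1%g).
    by elim/quotW => h; rewrite !lcosets_act_pi mulKg; exact: reprK.
  apply/seteqP; split=> p /=.
    by move=> [q Bq e]; rewrite actV -e actK.
  rewrite actV => Bp; exists (lcosets_act g^-1%g (heis_coset p)) => //.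
  by rewrite -{1}[g]invgK actK.
- by move=> x y z; rewrite /= heis_coset_addx.
- by move=> x y z; rewrite /= heis_coset_addy.
- by move=> x y z; rewrite /= heis_coset_addz.
Qed.

Lemma heisZ_is_lattice : is_lattice (heisZ R) R.
Proof.
split; first exact: heisZ_discrete.
exists heis_measure; split; last exact: heis_measure_invariant.
have -> : heis_measure setT = 1%E.
  rewrite -[LHS]/(cube_prob R (heis_coset @^-1` setT)) preimage_setT.
  exact: probability_setT.
by rewrite lte01 ltry.
Qed.

End HeisenbergLattice.

(** * The free group of rank two *)

Section GroupHomomorphism.
Local Open Scope group_scope.
Variables (G H : groupType) (f : {multiplicative G -> H}).

Lemma hom1 : f 1 = 1.
Proof. by apply: (mulgI (f 1)); rewrite -gmulfM !mulg1. Qed.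

Lemma homV : {morph f : x / x^-1}.
Proof. by move=> x; apply: (mulgI (f x)); rewrite -gmulfM !mulgV hom1. Qed.

End GroupHomomorphism.

HB.instance Definition _ (G : topologicalGroupType) (s : automorphism G) :=
  isMultiplicative.Build G G (aut_fun s) (autM s).

Section FreeExtension.
Variables (m : nat) (G : groupType) (f : 'I_m -> G).
Local Open Scope group_scope.

Definition letter_val (x : letter m) : G := if x.2 then (f x.1)^-1 else f x.1.

Definition word_val (s : seq (letter m)) : G := \prod_(x <- s) letter_val x.

Lemma letter_val_inv x : letter_val (letter_inv x) = (letter_val x)^-1.
Proof. by case: x => i [] //=; rewrite /letter_val /= invgK. Qed.

(** Cancelling a letter against its inverse does not change the value. *)
Lemma word_val_reduced_cons x s :
  word_val (reduced_cons x s) = letter_val x * word_val s.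
Proof.
rewrite /word_val; case: s => [|y s] /=; first by rewrite big_cons.
case: eqP => [->|_]; last by rewrite big_cons.
by rewrite big_cons letter_val_inv mulVKg.
Qed.

Lemma word_val_reduced_cat s t :
  word_val (reduced_cat s t) = word_val s * word_val t.
Proof.
elim: s => [|x s IHs] /=; first by rewrite /word_val big_nil mul1g.
by rewrite word_val_reduced_cons IHs mulgA /word_val big_cons.
Qed.

Definition free_ext (w : free_group m) : G := word_val (free_word w).

Fact free_extM : {morph free_ext : v w / v * w}.
Proof. by move=> v w; exact: word_val_reduced_cat. Qed.

HB.instance Definition _ := isMultiplicative.Build _ _ free_ext free_extM.

Lemma free_ext_gen i : free_ext (free_gen i) = f i.
Proof. by rewrite /free_ext /word_val big_seq1. Qed.

End FreeExtension.

Section FreeGroupTheory.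
Local Open Scope group_scope.

Lemma free_group_ind (m : nat) (P : free_group m -> Prop) :
    P 1 ->
    (forall i w, P w -> P (free_gen i * w)) ->
    (forall i w, P w -> P ((free_gen i)^-1 * w)) ->
  forall w, P w.
Proof.
move=> P1 Pg PV [s rs]; elim: s rs => [|[i b] s IHs] rs.
  by rewrite (_ : FreeGroup rs = 1) //; exact: val_inj.
have rs' : reduced s := path_sorted rs.
have -> : FreeGroup rs =
    (if b then (free_gen i)^-1 else free_gen i) * FreeGroup rs'.
  apply: val_inj => /=; rewrite -[LHS](reduced_consE rs).
  by case: b rs.
by case: b rs => rs; [apply: PV|apply: Pg].
Qed.

Lemma free_hom_eq (m : nat) (G : groupType)
    (h k : {multiplicative free_group m -> G}) :
  (forall i, h (free_gen i) = k (free_gen i)) -> h =1 k.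
Proof.
move=> hk; elim/free_group_ind => [|i w IH|i w IH].
- by rewrite !hom1.
- by rewrite !gmulfM hk IH.
- by rewrite !gmulfM !homV hk IH.
Qed.

End FreeGroupTheory.

Section FreeGroup2.
Local Open Scope group_scope.
Notation F2 := (free_group 2).

Definition gen_a : F2 := free_gen ord0.
Definition gen_b : F2 := free_gen ord_max.

Lemma free2_hom_eq (G : groupType) (h k : {multiplicative F2 -> G}) :
  h gen_a = k gen_a -> h gen_b = k gen_b -> h =1 k.
Proof.
move=> ha hb; apply: free_hom_eq => -[[|[|i]] lti] //.
  by rewrite (_ : Ordinal lti = ord0) //; exact: val_inj.
by rewrite (_ : Ordinal lti = ord_max) //; exact: val_inj.
Qed.

Definition pair_ext (G : groupType) (A B : G) : {multiplicative F2 -> G} :=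
  free_ext (fun i : 'I_2 => if i == ord0 then A else B).

Lemma pair_ext_a (G : groupType) (A B : G) : pair_ext A B gen_a = A.
Proof. exact: free_ext_gen. Qed.

Lemma pair_ext_b (G : groupType) (A B : G) : pair_ext A B gen_b = B.
Proof. exact: free_ext_gen. Qed.

Lemma discrete_automorphism (G : topologicalGroupType) (f g : G -> G) :
    (forall A : set G, open A) ->
    {morph f : x y / x * y} -> cancel f g -> cancel g f ->
  exists s : automorphism G, s =1 f.
Proof.
move=> oG fM fK gK.
have fP : `[< is_automorphism f >].
  apply/asboolP; split=> //; first by apply/continuousP.
  by exists g; split=> //; apply/continuousP.
by exists (Automorphism fP).
Qed.

Lemma free_automorphism (h k : {multiplicative F2 -> F2}) :
    k (h gen_a) = gen_a -> k (h gen_b) = gen_b ->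
    h (k gen_a) = gen_a -> h (k gen_b) = gen_b ->
  exists s : automorphism F2, s =1 h.
Proof.
move=> kha khb hka hkb; apply: (@discrete_automorphism _ _ k).
- by move=> A; exact: discrete_open.
- exact: gmulfM.
- exact: (@free2_hom_eq _ (k \o h) idfun).
- exact: (@free2_hom_eq _ (h \o k) idfun).
Qed.

(** Precomposing an automorphism that witnesses [liftable A B] with a Nielsen
    move performs a row operation on the pair (A, B): exchange, inversion of
    an entry, or multiplication of one entry by the other. *)
Section Lift.
Variables (G : groupType) (pi : {multiplicative F2 -> G}).

Definition liftable (A B : G) : Prop :=
  exists s : automorphism F2, pi (s gen_a) = A /\ pi (s gen_b) = B.

Lemma liftable_gen : liftable (pi gen_a) (pi gen_b).
Proof. by exists 1. Qed.

Lemma liftable_swap A B : liftable A B -> liftable B A.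
Proof.
move=> [s [<- <-]].
have [] := @free_automorphism (pair_ext gen_b gen_a) (pair_ext gen_b gen_a);
  do ?by rewrite !(pair_ext_a, pair_ext_b).
by move=> n nE; exists (s * n); split; rewrite /= nE !(pair_ext_a, pair_ext_b).
Qed.

Lemma liftable_inv A B : liftable A B -> liftable A^-1 B.
Proof.
move=> [s [<- <-]].
have [] := @free_automorphism
    (pair_ext gen_a^-1 gen_b) (pair_ext gen_a^-1 gen_b);
  do ?by rewrite ?(pair_ext_a, pair_ext_b, homV, invgK).
move=> n nE; exists (s * n); split; rewrite /= nE !(pair_ext_a, pair_ext_b)//.
by rewrite !homV.
Qed.

Lemma liftable_mulr A B : liftable A B -> liftable (A * B) B.
Proof.
move=> [s [<- <-]].
have [] := @free_automorphism (pair_ext (gen_a * gen_b) gen_b)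
    (pair_ext (gen_a * gen_b^-1) gen_b);
  do ?by rewrite !(pair_ext_a, pair_ext_b, gmulfM, homV, mulgK, mulgVK).
move=> n nE; exists (s * n); split; rewrite /= nE !(pair_ext_a, pair_ext_b)//.
by rewrite !gmulfM.
Qed.

Lemma liftable_divr A B : liftable A B -> liftable (A * B^-1) B.
Proof.
by move=> /liftable_swap/liftable_inv/liftable_swap/liftable_mulr/liftable_swap
  /liftable_inv; rewrite invgK => /liftable_swap.
Qed.

(** Here the automorphism is followed, not preceded, by an inner one. *)
Lemma liftable_conj w A B : liftable A B ->
  liftable (pi w * A * (pi w)^-1) (pi w * B * (pi w)^-1).
Proof.
move=> [s [<- <-]].
have [] := @discrete_automorphism F2
  (fun v => w * v * w^-1) (fun v => w^-1 * v * w).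
- by move=> A'; exact: discrete_open.
- by move=> u v /=; rewrite !mulgA mulgVK.
- by move=> v; rewrite !mulgA mulVg mul1g mulgVK.
- by move=> v; rewrite !mulgA mulgV mul1g mulgK.
by move=> c cE; exists (c * s); split; rewrite /= cE !gmulfM homV.
Qed.

End Lift.

End FreeGroup2.

(** * Endomorphisms of the integral Heisenberg group *)

Section IntegerHeisenberg.
Variable R : realType.
Local Open Scope ring_scope.

Notation Gamma := (subgroup (heisZ R)).

Lemma heis_inj (x y z x' y' z' : R) :
  heis x y z = heis x' y' z' -> [/\ x = x', y = y' & z = z'].
Proof.
move=> /(congr1 (@heis_mx R)) /matrixP e.
by have := (e 0 1, e 1 ord_max, e 0 ord_max); rewrite !mxE /= => -[[]].
Qed.

Fact heis_int_subproof (x y z : int) : heis x%:~R y%:~R z%:~R \in heisZ R.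
Proof. by rewrite heis_heisZ !intr_int. Qed.

Definition heis_int (x y z : int) : Gamma := Subgroup (heis_int_subproof x y z).

Lemma heis_int_eq (x y z x' y' z' : int) :
  x = x' -> y = y' -> z = z' -> heis_int x y z = heis_int x' y' z'.
Proof. by move=> -> -> ->. Qed.

Lemma heis_intM x y z x' y' z' :
  (heis_int x y z * heis_int x' y' z')%g =
  heis_int (x + x') (y + y') (z + z' + x * y').
Proof. by apply: val_inj => /=; rewrite !intrD intrM; exact: heis_mulE. Qed.

Lemma heis_int1 : 1%g = heis_int 0 0 0.
Proof. by apply: (mulgI (heis_int 0 0 0)); rewrite mulg1 heis_intM. Qed.

Lemma heis_intV x y z :
  (heis_int x y z)^-1%g = heis_int (- x) (- y) (x * y - z).
Proof.
apply: (mulgI (heis_int x y z)); rewrite mulgV heis_intM heis_int1.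
congr heis_int; ring.
Qed.

Lemma heis_int_inj x y z x' y' z' :
  heis_int x y z = heis_int x' y' z' -> [/\ x = x', y = y' & z = z'].
Proof.
by move=> /(congr1 val)/heis_inj[/intr_inj -> /intr_inj -> /intr_inj ->].
Qed.

Lemma heis_intP (g : Gamma) : exists x y z, g = heis_int x y z.
Proof.
case: g => g gZ; have /heisZP H := gZ.
have /intrP[x xE] := H 0 1; have /intrP[y yE] := H 1 ord_max.
have /intrP[z zE] := H 0 ord_max.
by exists x, y, z; apply: val_inj => /=; rewrite [LHS]heisE xE yE zE.
Qed.

(** [x, y, z] is the product of [0, y, 0], [x, 0, 0] and [0, 0, z], which
    are powers of the two generators and of their commutator [0, 0, 1]. *)
Lemma heis_int_gen (P : Gamma -> Prop) :
    (forall g h, P g -> P h -> P (g * h)%g) -> (forall g, P g -> P g^-1%g) ->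
    P (heis_int 1 0 0) -> P (heis_int 0 1 0) ->
  forall g, P g.
Proof.
move=> PM PV Pa Pb g; have [x [y [z ->]]] := heis_intP g.
have Ppow (k : int -> Gamma) : {morph k : u v / u + v >-> (u * v)%g} ->
    {morph k : u / - u >-> (u^-1)%g} -> P (k 1) -> forall u, P (k u).
  move=> kD kN Pk1; elim/int_ind => [|n IHn|n IHn].
  - by rewrite -(subrr 1) kD kN; apply: PM => //; apply: PV.
  - by rewrite intS kD; apply: PM.
  - by rewrite intS opprD kD kN; apply: PM => //; apply: PV.
have Pc : P (heis_int 0 0 1).
  have := PM _ _ (PM _ _ Pa Pb) (PM _ _ (PV _ Pa) (PV _ Pb)).
  by rewrite !heis_intV !heis_intM; congr P; apply: heis_int_eq; ring.
have -> : heis_int x y z =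
    (heis_int 0 y 0 * heis_int x 0 0 * heis_int 0 0 z)%g.
  by rewrite !heis_intM; apply: heis_int_eq; ring.
by apply: (PM); [apply: (PM)|];
  [apply: (Ppow (fun u => heis_int 0 u 0))
  |apply: (Ppow (fun u => heis_int u 0 0))
  |apply: (Ppow (fun u => heis_int 0 0 u))] => //;
  move=> *; rewrite ?heis_intM ?heis_intV; apply: heis_int_eq; ring.
Qed.

(** The binomial coefficient x choose 2, for an integer x of any sign. *)
Definition binz (x : int) : int := (x * (x - 1) %/ 2)%Z.

Lemma binz2 x : 2 * binz x = x * (x - 1).
Proof.
have [k xE] : exists k, x = k * 2 \/ x = k * 2 + 1.
  by exists (x %/ 2)%Z; lia.
have [w wE] : exists w, x * (x - 1) = w * 2.
  by case: xE => ->; [exists (k * (k * 2 - 1))|exists (k * (k * 2 + 1))]; ring.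
by rewrite /binz wE mulzK // mulrC.
Qed.

Lemma binz0 : binz 0 = 0. Proof. by []. Qed.

Lemma binz1 : binz 1 = 0. Proof. by []. Qed.

Lemma binzD x y : binz (x + y) = binz x + binz y + x * y.
Proof. by apply: (@mulfI _ 2) => //; rewrite !mulrDr !binz2; ring. Qed.

(** As [x, y, z] is b^y a^x c^z with a and b the generators and c their
    commutator, the endomorphism must send it to B^y A^x C^z, where C is the
    commutator of A and B. The binomial coefficients come from the powers
    [p, q, r]^x = [p x, q x, r x + p q (x choose 2)]. *)
Lemma heis_endo (A B : Gamma) : exists psi : Gamma -> Gamma,
  [/\ {morph psi : g h / (g * h)%g},
      psi (heis_int 1 0 0) = A & psi (heis_int 0 1 0) = B].
Proof.
have [p [q [r ->]]] := heis_intP A; have [s [t [u ->]]] := heis_intP B.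
pose f (x y z : int) : Gamma := heis_int (p * x + s * y) (q * x + t * y)
  (r * x + u * y + p * q * binz x + s * t * binz y + q * s * (x * y)
   + (p * t - q * s) * z).
pose c i j (g : Gamma) : int := Num.floor (heis_mx (val g) i j).
pose psi (g : Gamma) := f (c 0 1 g) (c 1 ord_max g) (c 0 ord_max g).
have psiE x y z : psi (heis_int x y z) = f x y z.
  by rewrite /psi /c /= !mxE /= !intrKfloor.
exists psi; split.
- move=> g h; have [x [y [z ->]]] := heis_intP g.
  have [x' [y' [z' ->]]] := heis_intP h.
  by rewrite heis_intM !psiE /f heis_intM !binzD; apply: heis_int_eq; ring.
- by rewrite psiE /f binz0 binz1; apply: heis_int_eq; ring.
- by rewrite psiE /f binz0 binz1; apply: heis_int_eq; ring.
Qed.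

End IntegerHeisenberg.

(** * Lifting automorphisms *)

Section Adapted.
Variable R : realType.
Local Open Scope ring_scope.

Notation Gamma := (subgroup (heisZ R)).
Notation F2 := (free_group 2).

Definition heis_pi : {multiplicative F2 -> Gamma} :=
  pair_ext (heis_int R 1 0 0) (heis_int R 0 1 0).

Lemma heis_pi_a : heis_pi gen_a = heis_int R 1 0 0.
Proof. exact: pair_ext_a. Qed.

Lemma heis_pi_b : heis_pi gen_b = heis_int R 0 1 0.
Proof. exact: pair_ext_b. Qed.

Lemma heis_pi_surj (g : Gamma) : exists w, heis_pi w = g.
Proof.
elim/heis_int_gen: g => [g h [v <-] [w <-]|g [w <-]||].
- by exists (v * w)%g; rewrite gmulfM.
- by exists (w^-1)%g; rewrite homV.
- by exists gen_a; exact: heis_pi_a.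
- by exists gen_b; exact: heis_pi_b.
Qed.

Lemma morph_heis_eq (f g : Gamma -> Gamma) :
    {morph f : x y / (x * y)%g} -> {morph g : x y / (x * y)%g} ->
    f (heis_int R 1 0 0) = g (heis_int R 1 0 0) ->
    f (heis_int R 0 1 0) = g (heis_int R 0 1 0) -> f =1 g.
Proof.
move=> fM gM fga fgb x; have [w <-] := heis_pi_surj x.
pose Mf := isMultiplicative.Build _ _ f fM.
pose Mg := isMultiplicative.Build _ _ g gM.
pose f' : {multiplicative Gamma -> Gamma} := HB.pack f Mf.
pose g' : {multiplicative Gamma -> Gamma} := HB.pack g Mg.
by apply: (@free2_hom_eq _ (f' \o heis_pi) (g' \o heis_pi));
  rewrite /= ?heis_pi_a ?heis_pi_b.
Qed.

Lemma hom_factor_heis (phi : {multiplicative F2 -> Gamma}) :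
  exists2 psi : Gamma -> Gamma,
    {morph psi : g h / (g * h)%g} & phi =1 psi \o heis_pi.
Proof.
have [psi [psiM psia psib]] := heis_endo (phi gen_a) (phi gen_b).
exists psi => //; pose Mpsi := isMultiplicative.Build _ _ psi psiM.
pose psi' : {multiplicative Gamma -> Gamma} := HB.pack psi Mpsi.
by apply: (@free2_hom_eq _ _ (psi' \o heis_pi));
  rewrite /= ?heis_pi_a ?heis_pi_b.
Qed.

Local Notation lift A B := (liftable heis_pi A B).

(** Conjugation by [x, y, z] sends [1, 0, 0] to [1, 0, - y] and [0, 1, 0] to
    [0, 1, x]. *)
Lemma liftable_conj_gen r u : lift (heis_int R 1 0 r) (heis_int R 0 1 u).
Proof.
have := liftable_gen heis_pi; rewrite heis_pi_a heis_pi_b.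
have [w wE] := heis_pi_surj (heis_int R u (- r) 0).
move=> /(liftable_conj w); rewrite wE !heis_intV !heis_intM.
by congr liftable; apply: heis_int_eq; ring.
Qed.

Lemma liftable_unitriangular q r u : lift (heis_int R 1 q r) (heis_int R 0 1 u).
Proof.
elim/int_ind: q r => [r|n IHn r|n IHn r]; first exact: liftable_conj_gen.
  have := liftable_mulr (IHn (r - u - 1)); rewrite heis_intM.
  by congr liftable; apply: heis_int_eq; rewrite ?intS; ring.
have := liftable_divr (IHn (r + u + 1)); rewrite heis_intV !heis_intM.
by congr liftable; apply: heis_int_eq; rewrite ?intS; ring.
Qed.

Lemma liftable_triangular p q r t u : `|p| = 1 -> `|t| = 1 ->
  lift (heis_int R p q r) (heis_int R 0 t u).
Proof.
move=> p1 t1.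
have pE : p = 1 \/ p = -1 by lia.
have tE : t = 1 \/ t = -1 by lia.
have lift1 q' r' : lift (heis_int R 1 q' r') (heis_int R 0 t u).
  case: tE => ->; first exact: liftable_unitriangular.
  have /liftable_swap/liftable_inv/liftable_swap :=
    liftable_unitriangular q' r' (- u).
  by rewrite heis_intV; congr liftable; apply: heis_int_eq; ring.
case: pE => ->; first exact: lift1.
have /liftable_inv := lift1 (- q) (- q - r).
by rewrite heis_intV; congr liftable; apply: heis_int_eq; ring.
Qed.

(** Euclid's algorithm on the first coordinates p and s, until s = 0; the
    determinant then forces p and t to be 1 or -1. *)
Lemma liftable_det p q r s t u : `|p * t - q * s| = 1 ->
  lift (heis_int R p q r) (heis_int R s t u).
Proof.
(* the weight 2 makes the swap decrease the measure when |p| < |s| *)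
have [n] := ubnP (`|p| + 2 * `|s|)%N.
elim: n p q r s t u => // n IHn p q r s t u ltn det1.
have [s0|s0] := eqVneq s 0.
  have : (`|p| * `|t|)%N == 1%N.
    by rewrite -abszM; apply/eqP; move: det1; rewrite s0 mulr0 subr0; lia.
  rewrite muln_eq1 => /andP[/eqP p1 /eqP t1].
  by rewrite s0; apply: liftable_triangular; lia.
have [ps|sp] := ltnP `|p| `|s|.
  by apply/liftable_swap/IHn; lia.
have [ppos|pneg] := leP 0 (p * s).
  have := @IHn (p - s) (q - t) (r - u - (p - s) * t) s t u.
  move=> /(_ _ _)/liftable_mulr; rewrite heis_intM.
  rewrite (_ : heis_int R _ _ (_ + _ * _) = heis_int R p q r).
    by apply; [nia|rewrite -det1; congr `|_|; ring].
  by apply: heis_int_eq; ring.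
have := @IHn (p + s) (q + t) (r + u + p * t) s t u.
move=> /(_ _ _)/liftable_divr.
rewrite -heis_intM mulgK; apply; first by nia.
by rewrite -det1; congr `|_|; ring.
Qed.

(** Surjectivity makes both basis vectors of Z^2 integer combinations of
    (p, q) and (s, t), so the determinant divides 1. *)
Lemma aut_det (f : automorphism Gamma) p q r s t u :
    f (heis_int R 1 0 0) = heis_int R p q r ->
    f (heis_int R 0 1 0) = heis_int R s t u ->
  `|p * t - q * s| = 1.
Proof.
move=> fa fb.
have fE g : exists x y z z', g = heis_int R x y z /\
    f g = heis_int R (p * x + s * y) (q * x + t * y) z'.
  elim/heis_int_gen: g.
  - move=> _ _ [x [y [z [c [-> e]]]]] [x' [y' [z' [c' [-> e']]]]].
    rewrite autM e e' !heis_intM; do 4!eexists; split; first by [].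
    by apply: heis_int_eq; [ring|ring|].
  - move=> _ [x [y [z [c [-> e]]]]]; rewrite homV /= e !heis_intV.
    by do 4!eexists; split; first by []; apply: heis_int_eq; [ring|ring|].
  - by exists 1, 0, 0, r; split=> //; rewrite fa; apply: heis_int_eq; ring.
  - by exists 0, 1, 0, u; split=> //; rewrite fb; apply: heis_int_eq; ring.
have sol a b : exists x y, p * x + s * y = a /\ q * x + t * y = b.
  have [x [y [z [c [gE fgE]]]]] := fE (aut_inv_fun f (heis_int R a b 0)).
  by exists x, y; move: fgE; rewrite aut_inv_funK => /heis_int_inj[-> ->].
have [x [y [e1 e2]]] := sol 1 0; have [x' [y' [e3 e4]]] := sol 0 1.
have : (p * t - q * s) * (x * y' - y * x') = 1.
  transitivity ((p * x + s * y) * (q * x' + t * y') -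
                (q * x + t * y) * (p * x' + s * y')); first by ring.
  by rewrite e1 e2 e3 e4; ring.
move=> /(congr1 absz); rewrite abszM => /eqP.
by rewrite muln_eq1 => /andP[/eqP ? _]; lia.
Qed.

(** The factors of pi o s and of pi o s^-1 are inverse to each other. *)
Lemma free_aut_push (s : automorphism F2) :
  exists f : automorphism Gamma, forall w, heis_pi (s w) = f (heis_pi w).
Proof.
have [psi psiM psiE] := hom_factor_heis (heis_pi \o s).
have [psi' _ psi'E] := hom_factor_heis (heis_pi \o (s^-1)%g).
have {}psiE w : heis_pi (s w) = psi (heis_pi w) := psiE w.
have {}psi'E w : heis_pi ((s^-1)%g w) = psi' (heis_pi w) := psi'E w.
have [||f fE] := @discrete_automorphism Gamma psi psi' (@heisZ_discrete R) psiM.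
- move=> g; have [w <-] := heis_pi_surj g.
  by rewrite -psiE -psi'E /= aut_funK.
- move=> g; have [w <-] := heis_pi_surj g.
  by rewrite -psi'E -psiE /= aut_inv_funK.
by exists f => w; rewrite fE.
Qed.

Definition heis_push (s : automorphism F2) : automorphism Gamma :=
  projT1 (cid (free_aut_push s)).

Lemma heis_pushE (s : automorphism F2) w :
  heis_pi (s w) = heis_push s (heis_pi w).
Proof. by rewrite /heis_push; case: cid. Qed.

(** Equality on the generators suffices; this gives both the multiplicativity
    and the surjectivity of [heis_push]. *)
Lemma heis_push_uniq (s : automorphism F2) (f : automorphism Gamma) :
    f (heis_pi gen_a) = heis_pi (s gen_a) ->
    f (heis_pi gen_b) = heis_pi (s gen_b) ->
  heis_push s = f.
Proof.
move=> fa fb; apply/val_inj/funext/morph_heis_eq; [exact: autM|exact: autM|..].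
- by rewrite /= -heis_pi_a -heis_pushE fa.
- by rewrite /= -heis_pi_b -heis_pushE fb.
Qed.

Fact heis_pushM : {morph heis_push : s v / (s * v)%g}.
Proof. by move=> s v; apply: heis_push_uniq; rewrite /= !heis_pushE. Qed.

HB.instance Definition _ := isMultiplicative.Build _ _ heis_push heis_pushM.

Lemma heis_push_surj (f : automorphism Gamma) : exists s, heis_push s = f.
Proof.
have [p [q [r fa]]] := heis_intP (f (heis_int R 1 0 0)).
have [s [t [u fb]]] := heis_intP (f (heis_int R 0 1 0)).
have [v [va vb]] := liftable_det r u (aut_det fa fb).
exists v; apply: heis_push_uniq; first by rewrite heis_pi_a va.
by rewrite heis_pi_b vb.
Qed.

Lemma heis_pi_adapted : adapted heis_pi.
Proof.
split.
- by apply/continuousP => A _; exact: discrete_open.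
- by apply/seteqP; split=> // g _; have [w <-] := heis_pi_surj g; exists w.
exists heis_push; split; last exact: heis_pushE.
  by apply/continuousP => A _; exact: discrete_open.
by apply/seteqP; split=> // f _; have [s <-] := heis_push_surj f; exists s.
Qed.

End Adapted.

Theorem proposition1 (R : realType) :
  is_lattice (heisZ R) R /\
  exists pi : {multiplicative free_group 2 -> subgroup (heisZ R)},
    [/\ subgroup_val (pi (free_gen ord0)) = heis 1%R 0%R 0%R,
        subgroup_val (pi (free_gen ord_max)) = heis 0%R 1%R 0%R &
        adapted pi].
Proof.
split; first exact: heisZ_is_lattice.
exists (heis_pi R); split; last exact: heis_pi_adapted.
- by rewrite heis_pi_a.
- by rewrite heis_pi_b.
Qed.
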